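(* Let $k$ be a natural number. There are marked groups $\Gamma$ and $\Delta$ with isomorphic Cayley graphs but for which $$\chi_B(F(2^\Gamma)) - \chi_B(F(2^\Delta)) = \chi_{BM}(F(2^\Gamma)) - \chi_{BM}(F(2^\Delta)) = k.$$
   Context: A graph on a set $X$ is a symmetric irreflexive relation $G\subset X\times X$. A (proper) coloring of $G$ is a function $c:X\to Y$ with $c(x)\neq c(y)$ whenever $(x,y)\in G$; it is a $k$-coloring if $|Y|=k$. When $X$ is Polish, $G$ is Borel if it is a Borel subset of $X\times X$; a coloring $c:X\to Y$ with $Y$ Polish is Borel (resp. Baire measurable) if $c$ is a Borel (resp. Baire measurable) function. The Borel chromatic number $\chi_B(G)$ (resp. Baire measurable chromatic number $\chi_{BM}(G)$) is the least $k$ such that $G$ admits a Borel (resp. Baire measurable) $k$-coloring. A marked group is a pair $(\Gamma,S)$ where $\Gamma$ is a finitely generated group and $S$ is a finite symmetric set of generators for $\Gamma$ not containing the identity; it is often denoted just $\Gamma$. The Cayley graph of $(\Gamma,S)$ is the graph on $\Gamma$ with an edge between $g$ and $h$ exactly when $sg=h$ for some $s\in S$. The left shift action $\Gamma\curvearrowright 2^\Gamma$ is $(g\cdot x)(h)=x(g^{-1}h)$ for $g,h\in\Gamma$, $x\in 2^\Gamma$, and $2^\Gamma$ has the product topology. Let $F(2^\Gamma)=\{x\in 2^\Gamma \mid \forall g\in\Gamma-\{\mathrm{id}\},\ g\cdot x\neq x\}$, a $G_\delta$ subspace of $2^\Gamma$ and hence a Polish space. The shift graph of $(\Gamma,S)$,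 also denoted $F(2^\Gamma)$, is the Borel graph on $F(2^\Gamma)$ with an edge between $x$ and $y$ exactly when $s\cdot x=y$ for some $s\in S$. *)

(* Defs.v *)
From HB Require Import structures.
From mathcomp Require Import all_boot all_order all_algebra.
From mathcomp Require Import all_classical all_reals all_analysis.

Set Implicit Arguments.
Unset Strict Implicit.
Unset Printing Implicit Defensive.

Import Order.TTheory GRing.Theory Num.Theory.
Local Open Scope classical_set_scope.

Record graph (X : Type) := Graph {
  edge :> X -> X -> Prop;
  edge_sym : forall x y, edge x y -> edge y x;
  edge_irrefl : forall x, ~ edge x x
}.

Definition graph_isomorphic (X Y : Type) (G : graph X) (H : graph Y) : Prop :=
  exists2 f : X -> Y, bijective f & forall x y, G x y <-> H (f x) (f y).

Definition coloring (X Y : Type) (G : graph X) (c : X -> Y) : Prop :=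
  forall x y, G x y -> c x <> c y.

Definition separable_space (T : topologicalType) : Prop :=
  exists2 D : set T, countable D & dense D.

(* [d] is a complete metric inducing the topology of [T]; nonnegativity of [d]
   follows from the first three clauses. *)
Definition complete_metric (R : realType) (T : topologicalType)
    (d : T -> T -> R) : Prop :=
  [/\ forall x y, d x y = 0%R <-> x = y,
      forall x y, d x y = d y x,
      forall x y z, (d x z <= d x y + d y z)%R,
      forall A : set T, open A <->
        (forall x, A x -> exists2 e : R, (0 < e)%R & [set y | (d x y < e)%R] `<=` A)
    & forall u : nat -> T,
        (forall e : R, (0 < e)%R -> exists N : nat, forall m n : nat,
           (N <= m)%N -> (N <= n)%N -> (d (u m) (u n) < e)%R) ->
        exists l : T, u @ \oo --> l].

Definition polish (R : realType) (T : topologicalType) : Prop :=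
  separable_space T /\ exists d : T -> T -> R, complete_metric d.

Definition borel_set (T : topologicalType) (A : set T) : Prop :=
  <<s @open T >> A.

Definition nowhere_dense (T : topologicalType) (A : set T) : Prop :=
  interior (closure A) = set0.

Definition meager (T : topologicalType) (A : set T) : Prop :=
  exists2 F : nat -> set T,
    (forall n, nowhere_dense (F n)) & A `<=` \bigcup_n F n.

Definition baire_property (T : topologicalType) (A : set T) : Prop :=
  exists2 U : set T, open U & meager ((A `\` U) `|` (U `\` A)).

Definition borel_function (X Y : topologicalType) (f : X -> Y) : Prop :=
  forall B : set Y, borel_set B -> borel_set (f @^-1` B).

Definition baire_measurable (X Y : topologicalType) (f : X -> Y) : Prop :=
  forall U : set Y, open U -> baire_property (f @^-1` U).

Definition borel_colorable (R : realType) (X : topologicalType) (G : graph X)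
    (k : nat) : Prop :=
  exists (Y : topologicalType) (c : X -> Y),
    [/\ polish R Y, ([set: Y] #= `I_k)%card, coloring G c & borel_function c].

Definition baire_colorable (R : realType) (X : topologicalType) (G : graph X)
    (k : nat) : Prop :=
  exists (Y : topologicalType) (c : X -> Y),
    [/\ polish R Y, ([set: Y] #= `I_k)%card, coloring G c & baire_measurable c].

(* Only finite chromatic numbers are represented: [is_chi_B R G n] says that the
   Borel chromatic number of [G] is the natural number [n]. *)
Definition is_least (P : nat -> Prop) (n : nat) : Prop :=
  P n /\ forall m, P m -> (n <= m)%N.

Definition is_chi_B (R : realType) (X : topologicalType) (G : graph X) :=
  is_least (borel_colorable R G).

Definition is_chi_BM (R : realType) (X : topologicalType) (G : graph X) :=
  is_least (baire_colorable R G).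

(* The last clause says that no proper subgroup contains [gens]. *)
Record markedGroup := MarkedGroup {
  mg_group :> groupType;
  gens : set mg_group;
  gens_finite : finite_set gens;
  gensV : forall s, gens s -> gens (s^-1)%g;
  gens1 : ~ gens 1%g;
  gens_generate : forall H : set mg_group,
    H 1%g -> (forall g h, H g -> H h -> H (g * h)%g) ->
    (forall g, H g -> H (g^-1)%g) -> gens `<=` H -> H = setT
}.
Arguments gens : clear implicits.

Section CayleyGraph.
Variable Gamma : markedGroup.

Definition cayley_edge (g h : Gamma) : Prop :=
  exists2 s, gens Gamma s & (s * g)%g = h.

Lemma cayley_edge_sym g h : cayley_edge g h -> cayley_edge h g.
Proof.
by case=> s Ss <-; exists (s^-1)%g; [exact: gensV|rewrite mulKg].
Qed.

Lemma cayley_edge_irrefl g : ~ cayley_edge g g.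
Proof.
case=> s Ss /(congr1 (fun x => x * g^-1)%g).
by rewrite mulgK mulgV => s1; apply: (@gens1 Gamma); rewrite -s1.
Qed.

Definition cayley_graph : graph Gamma :=
  Graph cayley_edge_sym cayley_edge_irrefl.

End CayleyGraph.
Arguments cayley_graph : clear implicits.

Section ShiftGraph.
Variable Gamma : markedGroup.

(* [{ptws Gamma -> bool}] is 2^Gamma with the product topology. *)
Definition shift (g : Gamma) (x : {ptws Gamma -> bool}) : {ptws Gamma -> bool} :=
  fun h => x (g^-1 * h)%g.

Definition free_part : set {ptws Gamma -> bool} :=
  [set x | forall g : Gamma, g <> 1%g -> shift g x <> x].

(* Here [free_part] is coerced to the type of its points, which carries the
   subspace topology. *)
Definition shift_edge (x y : free_part) : Prop :=
  exists2 s, gens Gamma s & shift s (set_val x) = set_val y.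

Lemma shift_edge_sym x y : shift_edge x y -> shift_edge y x.
Proof.
case=> s Ss sxy; exists (s^-1)%g; first exact: gensV.
by rewrite -sxy; apply/funext => h; rewrite /shift invgK mulKg.
Qed.

Lemma shift_edge_irrefl x : ~ shift_edge x x.
Proof.
case=> s Ss; apply: (set_valP x) => s1.
by apply: (@gens1 Gamma); rewrite -s1.
Qed.

Definition shift_graph : graph free_part :=
  Graph shift_edge_sym shift_edge_irrefl.

End ShiftGraph.
Arguments free_part : clear implicits.
Arguments shift_graph : clear implicits.

(* Main.v *)
From HB Require Import structures.
Require Import Defs.
From mathcomp Require Import all_boot all_order all_algebra.
From mathcomp Require Import all_classical all_reals all_analysis.
From mathcomp Require Import zify.

(** Let [m >= 3] and [A = (Z/m)^2].  Both groups are extensions of [A] by the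
    integers, whose generator [t] acts on [A] trivially in the untwisted group
    and by exchanging the two coordinates in the twisted one.  The generators
    are the [s t^e] with [-1 <= e <= 1] and both coordinates of [s] nonzero.
    This set of [s] is invariant under the exchange, so that undoing the twist
    height by height identifies the two Cayley graphs.  In
    both, the vertices of one height carry the tensor product of two complete
    graphs on [m] vertices, and vertices of adjacent heights are joined by the
    same rule: both coordinates differ.

    Write [f_z] for the coloring of the [m] by [m] grid that a coloring [c]
    of the shift graph induces on the [A]-orbit of [z].  With at most [2m-2]
    colors, either every row of the grid contains two cells of the same color,
    or every column does ([row_or_col]): otherwise some row and some column
    would consist of [2m-1] cells of distinct colors.  A coloring of the first
    type cannot be next to one of the second type ([row_col_clash]).

    - In the twisted group, [t] therefore exchanges the two types.  A Baire
      measurable [c] takes the same values around [z] and around [t^N z] for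
      some [z] and some odd [N] ([generic_recurrence]), which is absurd.  So at
      least [2m-1] colors are needed ([twisted_lower]).
    - In the untwisted group and with only [m] colors, [f_z] depends on one
      coordinate only and is the same for [z] and [t z].  Comparing [z] with
      [(1,1) t^N z] shows that [m] colors are not enough ([untwisted_lower]).

    Conversely, there is an open set of markers, spaced along each orbit with
    large but bounded gaps of height ([exists_markers]).  Start at each
    marker from the coloring by the first coordinate, counted from that marker;
    up to the next marker it must be deformed, one height at a time, into the
    coloring counted from the next marker ([coloring_of_paths]).  In the
    untwisted group the two differ by a rotation of [Z/m], which [m]
    particles on a cycle of [m+1] sites can perform one move at a time
    ([sliding]).  In the twisted group they may be colorings by different
    coordinates, and [m-1] additional colors suffice to go from any proper
    [m]-coloring to any other: give these colors to [m-1] of the columns, change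
    the remaining column, and release them ([twisted_coloring]).  The Borel
    and the Baire measurable chromatic numbers are thus both [2m-1] for the
    twisted and [m+1] for the untwisted group, with difference [m-2]; for
    difference 0, the same group can be used twice.  Below, [m] is [n + 3]. *)

Set Implicit Arguments.
Unset Strict Implicit.
Unset Printing Implicit Defensive.

Import Order.TTheory GRing.Theory Num.Theory.
(* Restores the shift action, whose name is also that of a translation of
   normed spaces. *)
Import Defs.
Local Open Scope classical_set_scope.

(** * Baire category and generic recurrence *)

Section Meager.
Variable T : topologicalType.
Implicit Types A B U : set T.

Lemma meager_sub A B : A `<=` B -> meager B -> meager A.
Proof. by move=> AB [F ndF BF]; exists F => //; apply: subset_trans BF. Qed.

Lemma nowhere_dense0 : nowhere_dense (set0 : set T).
Proof. by rewrite /nowhere_dense closure0 interior0. Qed.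

Lemma nowhere_dense_meager A : nowhere_dense A -> meager A.
Proof. by move=> ndA; exists (fun=> A) => // x Ax; exists 0%N. Qed.

Lemma meager0 : meager (set0 : set T).
Proof. exact/nowhere_dense_meager/nowhere_dense0. Qed.

Lemma meager_bigcup_nat (A : nat -> set T) :
  (forall n, meager (A n)) -> meager (\bigcup_n A n).
Proof.
move=> mA.
have [F FP] : exists F : nat -> nat -> set T,
    forall n, (forall j, nowhere_dense (F n j)) /\ A n `<=` \bigcup_j F n j.
  have /choice [F FP] : forall n, exists Fn : nat -> set T,
      (forall j, nowhere_dense (Fn j)) /\ A n `<=` \bigcup_j Fn j.
    by move=> n; have [Fn ? ?] := mA n; exists Fn.
  by exists F.
exists (fun k => if unpickle k is Some (n, j) then F n j else set0).
  move=> k; case: (unpickle k) => [[n j]|]; first exact: (FP n).1.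
  exact: nowhere_dense0.
move=> x [n _ Anx]; have [j _ Fnjx] := (FP n).2 x Anx.
by exists (pickle (n, j)) => //=; rewrite pickleK.
Qed.

Lemma meager_bigcup (I : Type) (D : set I) (A : I -> set T) :
  countable D -> (forall i, D i -> meager (A i)) -> meager (\bigcup_(i in D) A i).
Proof.
case/countable_injP => f injf mA.
apply: (@meager_sub _ (\bigcup_n \bigcup_(i in D `&` [set i | f i = n]) A i)).
  by move=> x [i Di Aix]; exists (f i) => //; exists i.
apply: meager_bigcup_nat => n.
have [[i [Di fi]]|nD] := pselect (exists i, D i /\ f i = n).
  apply: meager_sub (mA i Di) => x [j [Dj fj] Ajx].
  by rewrite (injf i j) ?inE // fi fj.
apply: meager_sub meager0 => x [j [Dj fj] Ajx].
by apply: nD; exists j.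
Qed.

Lemma meagerU A B : meager A -> meager B -> meager (A `|` B).
Proof.
move=> mA mB; apply: (@meager_sub _ (\bigcup_(b in [set: bool]) if b then A else B)).
  by move=> x [Ax|Bx]; [exists true|exists false].
by apply: meager_bigcup => [|[]].
Qed.

Lemma open_baire_property U : open U -> baire_property U.
Proof. by move=> oU; exists U => //; rewrite setDv setUid; exact: meager0. Qed.

(** A point interior to the closed set [closure U `\` U] would lie in [closure U]
    and have a neighborhood missing [U]. *)
Lemma nowhere_dense_frontier U : open U -> nowhere_dense (closure U `\` U).
Proof.
move=> oU; rewrite /nowhere_dense.
have cB : closed (closure U `\` U).
  by apply: closedI; [exact: closed_closure|exact: open_closedC].
rewrite -((closure_id _).1 cB) -subset0 => x /= /[dup] /interior_subset [clUx _].
move=> nbx; have [y [Uy iBy]] := clUx _ nbx.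
by have [] := iBy.
Qed.

Lemma baire_propertyC A : baire_property A -> baire_property (~` A).
Proof.
case=> U oU mAU; exists (~` closure U).
  by rewrite openC; exact: closed_closure.
apply: (@meager_sub _ (((A `\` U) `|` (U `\` A)) `|` (closure U `\` U))).
  move=> x [[nAx /contrapT clUx]|[nclUx /contrapT Ax]].
    have [Ux|nUx] := pselect (U x); first by left; right.
    by right.
  left; left; split => // Ux; apply: nclUx; exact: subset_closure.
by apply: meagerU => //; apply/nowhere_dense_meager/nowhere_dense_frontier.
Qed.

Lemma baire_property_bigcup (A : nat -> set T) :
  (forall n, baire_property (A n)) -> baire_property (\bigcup_n A n).
Proof.
move=> bA.
have /choice [U UP] : forall n, exists U, open U /\
    meager ((A n `\` U) `|` (U `\` A n)).
  by move=> n; have [U ? ?] := bA n; exists U.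
exists (\bigcup_n U n).
  by apply: bigcup_open => n _; exact: (UP n).1.
apply: (@meager_sub _ (\bigcup_n ((A n `\` U n) `|` (U n `\` A n)))).
  move=> x [[[n _ Anx] nUx]|[[n _ Unx] nAx]]; exists n => //.
    by left; split=> // Unx; apply: nUx; exists n.
  by right; split=> // Anx; apply: nAx; exists n.
by apply: meager_bigcup_nat => n; exact: (UP n).2.
Qed.

(** The sets with the Baire property form a sigma-algebra containing the open
    sets. *)
Lemma borel_baire_property A : borel_set A -> baire_property A.
Proof.
apply; split; last exact: open_baire_property.
split.
- exact/open_baire_property/open0.
- by move=> B bB; rewrite setTD; exact: baire_propertyC.
- exact: baire_property_bigcup.
Qed.

End Meager.

Section Cylinders.
Variable I : choiceType.
Local Notation X := {ptws I -> bool}.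
Implicit Types (x y : X) (W : seq I) (N : set X).

Definition cylinder x W : set X := [set y | forall h, h \in W -> y h = x h].

Lemma cylinder_refl x W : cylinder x W x.
Proof. by []. Qed.

Lemma cylinderP x W x' W' :
  cylinder x W x' -> {subset W <= W'} -> cylinder x' W' `<=` cylinder x W.
Proof. by move=> xx' WW' y yx' h hW; rewrite yx' ?xx' //; exact: WW'. Qed.

Lemma open_coord (h : I) (b : bool) : open [set x : X | x h = b].
Proof.
have -> : [set x : X | x h = b] = (@proj I (fun=> bool) h) @^-1` [set b] by [].
apply: open_comp; last exact: discrete_open.
by move=> x _; exact: proj_continuous.
Qed.

Lemma open_cylinder x W : open (cylinder x W).
Proof.
elim: W => [|h W IH].
  suff -> : cylinder x [::] = setT by exact: openT.
  by rewrite eqEsubset; split.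
suff -> : cylinder x (h :: W) = [set y : X | y h = x h] `&` cylinder x W.
  by apply: openI => //; exact: open_coord.
rewrite eqEsubset; split => [y yx|y [/= yh yW] h'].
  by split=> [|h' h'W]; apply: yx; rewrite inE ?eqxx ?h'W ?orbT.
by rewrite inE => /orP[/eqP->//|/yW].
Qed.

(** The sets containing a cylinder at [x] form a filter that converges to [x]
    coordinatewise, hence in the product topology. *)
Lemma cylinder_basis x (O : set X) : open O -> O x ->
  exists W, cylinder x W `<=` O.
Proof.
move=> oO Ox.
pose F : set_system (I -> bool) := [set A | exists W, cylinder x W `<=` A].
have FF : Filter F.
  split; first by exists [::].
    move=> A B [W WA] [W' WB]; exists (W ++ W') => y yx.
    by split; [apply: WA|apply: WB] => h hW; apply: yx; rewrite mem_cat hW ?orbT.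
  by move=> A B AB [W WA]; exists W; exact: subset_trans AB.
suff /(_ O) : {ptws, F --> (x : I -> bool)}.
  by apply; apply: open_nbhs_nbhs; split.
apply: (iffRL (@pointwise_cvgP (discrete_topology I) bool F x FF)).
move=> h A /nbhs_singleton Axh.
by exists [:: h] => y /(_ h); rewrite inE eqxx => /(_ isT) /= ->.
Qed.

(** The form in which nowhere density is used: the set can be avoided by fixing
    finitely many further coordinates. *)
Lemma nowhere_denseP N : nowhere_dense N <->
  forall x W, exists x' W', [/\ cylinder x W x', {subset W <= W'}
    & cylinder x' W' `&` N = set0].
Proof.
split=> [ndN x W|H].
  have [x' [xx' nx']] : exists x', cylinder x W x' /\ ~ closure N x'.
    apply: contrapT => H; suff : interior (closure N) x by rewrite ndN.
    apply: (@filterS _ _ _ (cylinder x W)).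
      by move=> y yx; apply: contrapT => ny; apply: H; exists y.
    by apply: open_nbhs_nbhs; split=> //; exact: open_cylinder.
  have [] := @cylinder_basis x' (~` closure N) _ nx'.
    by rewrite openC; exact: closed_closure.
  move=> W1 W1N; exists x', (W1 ++ W); split=> //.
    by move=> h hW; rewrite mem_cat hW orbT.
  rewrite -subset0 => y [yx' Ny]; apply: (W1N y); last exact: subset_closure.
  by move=> h hW; apply: yx'; rewrite mem_cat hW.
rewrite /nowhere_dense -subset0 => x /= ix.
have [W WN] := cylinder_basis (open_interior _) ix.
have [x' [W' [xx' _ W'N]]] := H x W.
have [|y [Ny yx']] := interior_subset (WN _ xx') (cylinder x' W').
  by apply: open_nbhs_nbhs; split=> //; exact: open_cylinder.
suff : set0 y by [].
by rewrite -W'N.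
Qed.

(** The Baire category theorem.  Nested cylinders avoiding more and more of the
    nowhere dense sets determine a point, coordinate by coordinate. *)
Lemma meager_cylinder (M : set X) x W : meager M ->
  exists2 y, cylinder x W y & ~ M y.
Proof.
case=> N ndN MN.
have step (n : nat) (p : X * seq I) : exists q : X * seq I,
    [/\ cylinder p.1 p.2 q.1, {subset p.2 <= q.2} & cylinder q.1 q.2 `&` N n = set0].
  case: p => z V; have /nowhere_denseP/(_ z V) [x' [W' H]] := ndN n.
  by exists (x', W').
have {step} [f fP] : exists f : nat -> X * seq I -> X * seq I, forall n p,
    [/\ cylinder p.1 p.2 (f n p).1, {subset p.2 <= (f n p).2}
      & cylinder (f n p).1 (f n p).2 `&` N n = set0].
  have /choice [f fP] := fun np : nat * (X * seq I) => step np.1 np.2.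
  by exists (fun n p => f (n, p)) => n p; exact: fP (n, p).
pose s := fix s n := if n is n'.+1 then f n' (s n') else (x, W).
have sS n : [/\ cylinder (s n).1 (s n).2 (s n.+1).1, {subset (s n).2 <= (s n.+1).2}
      & cylinder (s n.+1).1 (s n.+1).2 `&` N n = set0] by exact: fP.
have smon n j : {subset (s n).2 <= (s (n + j)%N).2}
    /\ cylinder (s n).1 (s n).2 (s (n + j)%N).1.
  elim: j => [|j [IH1 IH2]]; first by rewrite addn0; split=> //; exact: cylinder_refl.
  rewrite addnS; have [s1 s2 _] := sS (n + j)%N.
  by split=> [h /IH1/s2 //|]; apply: cylinderP s1 => // h /IH1.
(* All cylinders that fix [h] prescribe the same value at [h]; a coordinate
   that is never fixed gets a default value. *)
pose y : X := fun h => if pselect (exists n, h \in (s n).2) is left e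
  then (s (projT1 (cid e))).1 h else false.
have yP n : cylinder (s n).1 (s n).2 y.
  move=> h hn; rewrite /y; case: pselect => [e|[]]; last by exists n.
  case: (cid e) => j /= hj; have [jn|nj] := leqP j n.
    by have [_ /(_ h hj)] := smon j (n - j)%N; rewrite subnKC // => ->.
  by have [_ /(_ h hn)] := smon n (j - n)%N; rewrite subnKC // ltnW.
exists y; first exact: (yP 0%N).
move=> /MN [n _ Nny]; have [_ _] := sS n.
by rewrite -subset0; apply; split; [exact: yP|exact: Nny].
Qed.

(** Carries meager sets of the free part over to the whole space, where the
    Baire category theorem holds. *)
Lemma nowhere_dense_image (F : set X) (N : set F) :
  nowhere_dense N -> nowhere_dense (set_val @` N).
Proof.
move=> ndN; apply/nowhere_denseP => x W.
pose V : set F := set_val @^-1` cylinder x W.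
have oV : open V by exists (cylinder x W) => //; exact: open_cylinder.
have [[z [Vz nz]]|H] := pselect (exists z, V z /\ ~ closure N z).
  have : open (~` closure N) by rewrite openC; exact: closed_closure.
  case=> O oO OE.
  have [|W1 W1O] := @cylinder_basis (set_val z) O oO.
    by have : (set_val @^-1` O) z by rewrite OE.
  exists (set_val z), (W1 ++ W); split=> //.
    by move=> h hW; rewrite mem_cat hW orbT.
  rewrite -subset0 => y [yz [n Nn ny]]; have : (~` closure N) n.
    rewrite -OE /= ny; apply: W1O => h hW; apply: yz; by rewrite mem_cat hW.
  by apply; exact: subset_closure.
exists x, W; split=> //; rewrite -subset0 => y [yx [n Nn ny]].
suff : interior (closure N) n by rewrite ndN.
apply: (@filterS _ _ _ V).
  by move=> z Vz; apply: contrapT => nz; apply: H; exists z.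
by apply: open_nbhs_nbhs; split=> //; rewrite /V /= ny.
Qed.

Lemma meager_image (F : set X) (M : set F) : meager M -> meager (set_val @` M).
Proof.
case=> N ndN MN; exists (fun n => set_val @` N n).
  by move=> n; exact: nowhere_dense_image.
by move=> _ [z /MN [n _ Nz] <-]; exists n => //; exists z.
Qed.

End Cylinders.

Section Shift.
Variable Gamma : markedGroup.
Implicit Types (g h : Gamma) (x y : {ptws Gamma -> bool}) (z : free_part Gamma).

Lemma shift1 x : shift 1%g x = x.
Proof. by apply/funext => h; rewrite /shift invg1 mul1g. Qed.

Lemma shiftM g h x : shift (g * h)%g x = shift g (shift h x).
Proof. by apply/funext => a; rewrite /shift invgM mulgA. Qed.

Lemma shift_cylinder g x W y : cylinder x [seq (g^-1 * h)%g | h <- W] y ->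
  cylinder (shift g x) W (shift g y).
Proof. by move=> yx h hW; rewrite /shift yx //; apply: map_f. Qed.

Lemma open_shift g (O : set {ptws Gamma -> bool}) :
  open O -> open (shift g @^-1` O).
Proof.
move=> oO; rewrite openE => x /(cylinder_basis oO) [W WO].
apply: (@filterS _ _ _ (cylinder x [seq (g^-1 * h)%g | h <- W])).
  by move=> y /shift_cylinder/WO.
by apply: open_nbhs_nbhs; split=> //; exact: open_cylinder.
Qed.

Lemma nowhere_dense_shift g (N : set {ptws Gamma -> bool}) :
  nowhere_dense N -> nowhere_dense (shift g @^-1` N).
Proof.
move=> /nowhere_denseP ndN; apply/nowhere_denseP => x W.
have [x' [W' [xx' WW' N0]]] := ndN (shift g x) [seq (g * h)%g | h <- W].
exists (shift g^-1%g x'), [seq (g^-1 * h)%g | h <- W']; split.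
- move=> h hW; rewrite /shift invgK xx'; first by rewrite /shift mulKg.
  exact: map_f.
- move=> h hW; rewrite -(mulKg g h). exact/map_f/WW'/map_f.
- rewrite -subset0 => y [/shift_cylinder + Ny].
  rewrite -shiftM mulgV shift1 => x'y.
  suff : set0 (shift g y) by [].
  by rewrite -N0.
Qed.

Lemma meager_shift g (M : set {ptws Gamma -> bool}) :
  meager M -> meager (shift g @^-1` M).
Proof.
case=> N ndN MN; exists (fun n => shift g @^-1` N n).
  by move=> n; exact: nowhere_dense_shift.
by move=> y /MN.
Qed.

Lemma free_part_shift g x : free_part Gamma x -> free_part Gamma (shift g x).
Proof.
move=> Fx h h1 hgx; apply: (Fx (g^-1 * h * g)%g).
  move=> e; apply: h1; apply: (mulgI g^-1%g); apply: (mulIg g).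
  by rewrite e mulg1 mulVg.
by rewrite !shiftM hgx -shiftM mulVg shift1.
Qed.

Definition free_point x (Fx : free_part Gamma x) : free_part Gamma :=
  exist _ x (mem_set Fx).

Definition free_shift g z : free_part Gamma :=
  free_point (@free_part_shift g _ (set_valP z)).

Lemma val_free_shift g z : set_val (free_shift g z) = shift g (set_val z).
Proof. by []. Qed.

Lemma free_part_inj : injective (set_val : free_part Gamma -> _).
Proof. exact: val_inj. Qed.

Lemma free_shiftM g h z : free_shift (g * h)%g z = free_shift g (free_shift h z).
Proof. by apply: free_part_inj; rewrite !val_free_shift shiftM. Qed.

Lemma free_shift1 z : free_shift 1%g z = z.
Proof. by apply: free_part_inj; rewrite val_free_shift shift1. Qed.

Lemma shift_graphP z z' :
  shift_graph Gamma z z' <-> exists2 s, gens Gamma s & free_shift s z = z'.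
Proof.
split=> [[s Ss e]|[s Ss <-]]; last by exists s.
by exists s => //; apply: free_part_inj.
Qed.

(** Outside of finitely many prescribed coordinates there is still an [h], and
    giving it a value different from that of [g^-1 h] breaks the invariance. *)
Lemma nowhere_dense_fixed g : (forall W : seq Gamma, exists h, h \notin W) ->
  g <> 1%g -> nowhere_dense [set x | shift g x = x].
Proof.
move=> infG g1; apply/nowhere_denseP => x W; have [h hW] := infG W.
pose x' : {ptws Gamma -> bool} :=
  fun a => if a == h then ~~ x (g^-1 * h)%g else x a.
exists x', [:: h, (g^-1 * h)%g & W]; split.
- by move=> a aW; rewrite /x'; case: eqP => // ah; rewrite -ah aW in hW.
- by move=> a aW; rewrite !inE aW !orbT.
- rewrite -subset0 => y [yx' /(congr1 (fun f => f h))]; rewrite /shift.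
  rewrite !yx' ?inE ?eqxx ?orbT // /x' eqxx.
  case: eqP => [e|_]; last by case: (x _).
  case: g1; apply: (mulgI g^-1%g); apply: (mulIg h).
  by rewrite mulVg mul1g mulg1.
Qed.

(** A topological analogue of mixing for Baire measurable colorings: near a
    generic [x], the colors of the finitely many [e x] are determined by finitely
    many coordinates of [x].  If [g] moves this finite set of coordinates off
    itself, then a generic [y] can agree there with [x] and at the same time have
    [g y] agree there with [x]. *)
Lemma generic_recurrence (k : nat) (c : free_part Gamma -> 'I_k) (E : seq Gamma) :
  countable [set: Gamma] -> (forall W : seq Gamma, exists h, h \notin W) ->
  (forall i, baire_property (c @^-1` [set i])) ->
  exists W : seq Gamma, forall g, g \notin W ->
    exists z, forall e, e \in E -> c (free_shift e z) = c (free_shift (e * g)%g z).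
Proof.
move=> cG infG bc.
have /choice [V VP] : forall i, exists V : set {ptws Gamma -> bool}, open V /\
    meager ((c @^-1` [set i] `\` (set_val @^-1` V)) `|`
            ((set_val @^-1` V) `\` c @^-1` [set i])).
  by move=> i; have [U [V oV <-] mU] := bc i; exists V.
pose D i := (c @^-1` [set i] `\` (set_val @^-1` V i)) `|`
            ((set_val @^-1` V i) `\` c @^-1` [set i]).
(* [M] collects everything a generic point must avoid: points that are not
   free, and points with a translate at which some color class differs from the
   open set that approximates it. *)
pose M := (\bigcup_(g in [set g : Gamma | g <> 1%g]) [set x | shift g x = x])
  `|` \bigcup_(g in [set: Gamma]) \bigcup_(i in [set: 'I_k])
        (shift g @^-1` (set_val @` D i)).
have mM : meager M.
  apply: meagerU.
    apply: meager_bigcup => [|g g1]; first last.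
      exact/nowhere_dense_meager/nowhere_dense_fixed.
    exact: sub_countable (subset_card_le (@subsetT _ _)) cG.
  apply: meager_bigcup => // g _; apply: meager_bigcup => // i _.
  exact/meager_shift/meager_image/(VP i).2.
have MF x : ~ M x -> free_part Gamma x.
  by move=> nMx g g1 gx; apply: nMx; left; exists g.
have MV z g i : ~ M (set_val z) ->
    V i (shift g (set_val z)) <-> c (free_shift g z) = i.
  move=> nM; split=> H; apply: contrapT => nH; apply: nM; right;
    exists g => //; exists i => //; exists (free_shift g z) => //.
    by right.
  by left.
have [x _ nMx] := meager_cylinder (fun=> false) [::] mM.
pose z0 := free_point (MF x nMx).
have [W1 W1P] : exists W1 : seq Gamma, forall y, cylinder x W1 y ->
    forall e, e \in E -> V (c (free_shift e z0)) (shift e y).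
  elim: E => [|e E [W WP]]; first by exists [::].
  have oe : open (shift e @^-1` V (c (free_shift e z0))).
    by apply: open_shift; exact: (VP _).1.
  have [W' W'P] : exists W', cylinder x W' `<=` shift e @^-1` V (c (free_shift e z0)).
    by apply: cylinder_basis => //; apply/(MV z0).
  exists (W' ++ W) => y yx e'; rewrite inE => /orP[/eqP->|e'E].
    by apply: W'P => h hW; apply: yx; rewrite mem_cat hW.
  by apply: WP => // h hW; apply: yx; rewrite mem_cat hW orbT.
exists [seq (h * h'^-1)%g | h <- W1, h' <- W1] => g gW.
pose y0 : {ptws Gamma -> bool} := fun h => if h \in W1 then x h else x (g * h)%g.
have [y yy0 nMy] := meager_cylinder y0 (W1 ++ [seq (g^-1 * h)%g | h <- W1]) mM.
have yx : cylinder x W1 y.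
  by move=> h hW; rewrite yy0 ?mem_cat ?hW // /y0 hW.
have gyx : cylinder x W1 (shift g y).
  move=> h hW; rewrite /shift yy0; last by rewrite mem_cat map_f ?orbT.
  rewrite /y0 mulVKg; case: ifPn => // hW'; case/negP: gW.
  by apply/allpairsP; exists (h, (g^-1 * h)%g); rewrite invgM invgK mulVKg.
pose z := free_point (MF y nMy).
exists z => e eE.
rewrite (iffLR (MV z e _ nMy) (W1P _ yx e eE)); apply/esym.
apply: (iffLR (MV z (e * g)%g _ nMy)).
by rewrite shiftM; exact: W1P.
Qed.

End Shift.

(** * Colorings by finitely many colors *)

Section FiniteColorings.
Variables (R : realType).

Lemma discrete_complete_metric (Y : discreteTopologicalType) :
  complete_metric (fun x y : Y => (x != y)%:R%R : R).
Proof.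
have near1 (x y : Y) : ((x != y)%:R < 1 :> R)%R -> y = x.
  by case: eqVneq => // _; rewrite ltxx.
split.
- by move=> x y; case: eqVneq => [->|/eqP xy]; split=> // /eqP; rewrite oner_eq0.
- by move=> x y; rewrite eq_sym.
- move=> x y z; case: eqVneq => [_|xz]; first by rewrite addr_ge0 ?ler0n.
  case: eqVneq => [xy|xy]; last by rewrite lerDl ler0n.
  by rewrite -xy xz add0r.
- move=> A; split=> [_ x Ax|_]; last exact: discrete_open.
  by exists 1%R => // y /near1 ->.
- move=> u Cu; have [N NP] := Cu 1%R ltr01; exists (u N).
  move=> A /nbhs_singleton AuN; exists N => // n /= Nn.
  by rewrite (near1 (u N) (u n)) //; exact: NP.
Qed.

Lemma finite_discrete_polish n : polish R (discrete_topology 'I_n).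
Proof.
split; last by eexists; exact: discrete_complete_metric.
exists setT; first exact: (@countableP 'I_n).
by move=> A A0 _; rewrite setIT.
Qed.

Lemma polish_accessible (Y : topologicalType) : polish R Y -> accessible_space Y.
Proof.
case=> _ [d [d0 dC dT dO _]] x y xy; exists (~` [set y]).
split; [|by rewrite inE; exact/eqP|by rewrite inE; apply].
apply/dO => z /= zy.
have dzy : (0 < d z y)%R.
  have dzy : (d z y != 0)%R by apply/eqP => /d0.
  have := dT z y z; rewrite (iffRL (d0 z z) erefl) (dC y z) -mulr2n.
  by rewrite pmulrn_lge0 // le_eqVlt eq_sym (negPf dzy).
by exists (d z y) => // w /= dw wy; rewrite wy ltxx in dw.
Qed.

Section Graph.
Variables (X : topologicalType) (G : graph X).

(** The colorings constructed below are continuous, which yields both kinds of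
    colorability at once. *)
Lemma clopen_colorable n (c : X -> 'I_n) : coloring G c ->
  (forall i, open (c @^-1` [set i])) ->
  borel_colorable R G n /\ baire_colorable R G n.
Proof.
move=> cG oc; have oB (B : set 'I_n) : open (c @^-1` B).
  suff -> : c @^-1` B = \bigcup_(i in B) c @^-1` [set i].
    by apply: bigcup_open.
  by rewrite eqEsubset; split=> [x Bx|x [i Bi /= cxi]]; [exists (c x)|rewrite /= cxi].
have cardY : ([set: discrete_topology 'I_n] #= `I_n)%card.
  by rewrite card_eq_sym; exact: card_II.
split; exists (discrete_topology 'I_n), c; split=> //.
- exact: finite_discrete_polish.
- by move=> B _; apply: sub_sigma_algebra; exact: oB.
- exact: finite_discrete_polish.
- by move=> B _; apply: open_baire_property; exact: oB.
Qed.

Lemma borel_colorable_baire n : borel_colorable R G n -> baire_colorable R G n.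
Proof.
case=> Y [c [pY cardY cG bc]]; exists Y, c; split=> // U oU.
apply: borel_baire_property; apply: bc; exact: sub_sigma_algebra.
Qed.

(** In a finite metrizable space every set is open, so only the number of colors
    matters. *)
Lemma baire_colorableP n : baire_colorable R G n ->
  exists2 c : X -> 'I_n, coloring G c & forall i, baire_property (c @^-1` [set i]).
Proof.
case=> Y [c [pY cardY cG bc]].
have [f [fI finj _]] := elimT card_set_bijP cardY.
have fn y : (f y < n)%N by exact: (fI y).
exists (fun x => Ordinal (fn (c x))) => [x y /cG cxy [] /finj|i].
  by move=> e; apply: cxy; apply: e; rewrite inE.
apply: (bc [set y | Ordinal (fn y) = i]).
rewrite -closedC; apply: (iffLR accessible_finite_set_closed (polish_accessible pY)).
apply: (@sub_finite_set _ _ setT) => //.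
by apply/finite_setP; exists n.
Qed.

End Graph.
End FiniteColorings.

(** * Markers *)

Section Markers.
Variable Gamma : markedGroup.
Local Notation X := {ptws Gamma -> bool}.
Implicit Types (x y : X) (A : set X) (B : seq Gamma).

(** The union of the sets [g^-1 A] for [g] in [B]. *)
Definition translates B A : set X := [set x | exists2 g, g \in B & A (shift g x)].

Lemma clopen_translates B A : clopen A -> clopen (translates B A).
Proof.
move=> [oA cA]; elim: B => [|g B [oB cB]].
  rewrite (_ : translates [::] A = set0); last first.
    by rewrite -subset0 => x [].
  exact: clopen0.
rewrite (_ : translates (g :: B) A = shift g @^-1` A `|` translates B A).
  split; first by apply: openU => //; exact: open_shift.
  by apply: closedU => //; rewrite -openC; apply: (@open_shift _ g (~` A)); rewrite openC.
rewrite eqEsubset; split=> [x [h]|x [Ax|[h hB Ax]]].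
- by rewrite inE => /orP[/eqP->|hB] Ax; [left|right; exists h].
- by exists g => //; rewrite inE eqxx.
- by exists h => //; rewrite inE hB orbT.
Qed.

(** Runs through the sets [V i], keeping each time the points with no
    [B]-translate among those kept before. *)
Fixpoint greedy (V : nat -> set X) B n : set X :=
  if n is n'.+1 then greedy V B n' `|` (V n' `\` translates B (greedy V B n'))
  else set0.

Lemma clopen_greedy V B n : (forall i, clopen (V i)) -> clopen (greedy V B n).
Proof.
move=> cV; elim: n => [|n IH] /=; first exact: clopen0.
apply: clopenU => //; have [oT cT] := clopen_translates B IH.
by have [oV clV] := cV n; rewrite setDE; split; [apply: openI|apply: closedI];
  rewrite ?openC ?closedC.
Qed.

(** A free point [x] differs from each of its finitely many translates [g x] at
    some coordinate; the finite pattern of [x] at the coordinates involved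
    defines a clopen set disjoint from its own translates.  There are countably
    many finite patterns. *)
Lemma separating_cover B : countable [set: Gamma] ->
  exists V : nat -> set X,
  [/\ forall n, clopen (V n),
      forall x, free_part Gamma x -> exists n, V n x
    & forall n x g, g \in B -> g <> 1%g -> V n x -> ~ V n (shift g x)].
Proof.
move=> /countable_injP [f finj].
pose e (k : nat) : Gamma := if pselect (exists h, f h = k) is left H
  then projT1 (cid H) else 1%g.
have fe h : e (f h) = h.
  rewrite /e; case: pselect => [H|[]]; last by exists h.
  by case: (cid H) => h' /= /finj; apply; rewrite inE.
pose U (p : seq (nat * bool)) : set X :=
  [set x | forall q, q \in p -> x (e q.1) = q.2].
have clU p : clopen (U p).
  elim: p => [|q p [oU cU]].
    by rewrite (_ : U [::] = setT); [exact: clopenT|rewrite -subTset].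
  rewrite (_ : U (q :: p) = [set x : X | x (e q.1) = q.2] `&` U p).
    split; first by apply: openI => //; exact: open_coord.
    apply: closedI => //; rewrite -openC.
    rewrite (_ : ~` _ = [set x : X | x (e q.1) = ~~ q.2]); first exact: open_coord.
    rewrite eqEsubset; split=> x /=; first by case: (x _) q.2 => [] [].
    by move=> ->; case: q.2.
  rewrite eqEsubset; split => [x xU|x [/= xq xp] q'].
    by split=> [|q' q'p]; apply: xU; rewrite inE ?eqxx ?q'p ?orbT.
  by rewrite inE => /orP[/eqP->//|/xp].
pose good p := forall x g, g \in B -> g <> 1%g -> U p x -> ~ U p (shift g x).
exists (fun n => if unpickle n is Some p then
  if pselect (good p) is left _ then U p else set0 else set0); split.
- move=> n; case: (unpickle n) => [p|]; last exact: clopen0.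
  by case: (pselect _) => // _; exact: clopen0.
- move=> x Fx.
  have [p [gp xp]] : exists p, good p /\ U p x; last first.
    by exists (pickle p); rewrite pickleK; case: pselect.
  suff [p [xp gp]] : exists p, U p x /\
      forall y g, g \in B -> g <> 1%g -> U p y -> ~ U p (shift g y) by exists p.
  elim: B {good} => [|g B [p [xp gp]]].
    by exists [::].
  have [->|/eqP g1] := eqVneq g 1%g.
    by exists p; split=> // y h; rewrite inE => /orP[/eqP->//|]; exact: gp.
  have [h hP] : exists h, x (g^-1 * h)%g <> x h.
    apply: contrapT => H; apply: (Fx g g1); apply/funext => h.
    by apply: contrapT => xh; apply: H; exists h.
  exists [:: (f h, x h), (f (g^-1 * h)%g, x (g^-1 * h)%g) & p]; split.
    by move=> q; rewrite !inE => /or3P[/eqP->|/eqP->|/xp] //=; rewrite fe.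
  move=> y g'; rewrite inE => /orP[/eqP->|g'B] g'1 Uy Ugy; last first.
    by apply: (gp y g') => // q qp; [apply: Uy|apply: Ugy]; rewrite !inE qp !orbT.
  apply: hP; have := Uy (f (g^-1 * h)%g, x (g^-1 * h)%g).
  rewrite !inE eqxx orbT /= fe => <- //.
  by have := Ugy (f h, x h); rewrite !inE eqxx /= fe => /(_ isT).
- move=> n x g gB g1; case: (unpickle n) => [p|] //.
  by case: (pselect _) => // gp; exact: gp.
Qed.

(** A maximal [B]-discrete set exists by a greedy construction along a countable
    clopen cover by [B]-discrete sets. *)
Lemma exists_markers B : countable [set: Gamma] ->
  1%g \in B -> (forall g, g \in B -> (g^-1)%g \in B) ->
  exists M : set X, [/\ open M,
    forall x g, M x -> g \in B -> M (shift g x) -> g = 1%g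
    & forall x, free_part Gamma x -> exists2 g, g \in B & M (shift g x)].
Proof.
move=> cG B1 BV; have [V [clV Vcov Vsep]] := separating_cover B cG.
have mono n m x : (n <= m)%N -> greedy V B n x -> greedy V B m x.
  move=> nm; rewrite -(subnKC nm); elim: (m - n)%N => [|j IH]; first by rewrite addn0.
  by move=> /IH xj; rewrite addnS /=; left.
exists (\bigcup_n greedy V B n); split.
- by apply: bigcup_open => n _; exact: (clopen_greedy _ _ clV).1.
- move=> x g [i _ xi] gB [j _ gxj].
  have {xi gxj} [n [xn gxn]] : exists n, greedy V B n x /\ greedy V B n (shift g x).
    exists (maxn i j).
    by split; [apply: mono xi; exact: leq_maxl|apply: mono gxj; exact: leq_maxr].
  apply: contrapT => g1; elim: n xn gxn => [|n IH] //=.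
  move=> [xn|[Vx nx]] [gxn|[Vgx ngx]].
  + exact: IH.
  + apply: ngx; exists (g^-1)%g; first exact: BV.
    by rewrite -shiftM mulVg shift1.
  + by apply: nx; exists g.
  + exact: (Vsep n x g).
- move=> x /Vcov [n Vx].
  have [[g gB xg]|nx] := pselect (translates B (greedy V B n) x).
    by exists g => //; exists n.
  by exists 1%g => //; exists n.+1 => //; rewrite shift1; right.
Qed.

End Markers.

Local Open Scope ring_scope.

(** * The two groups *)

Definition torus (n : nat) := ('I_n.+3 * 'I_n.+3)%type.

Section Torus.
Variable n : nat.
Implicit Types u v w : torus n.

Definition apart u v := (u.1 != v.1) && (u.2 != v.2).

Definition flip (b : bool) v : torus n := if b then (v.2, v.1) else v.

Lemma flip0 b : flip b 0 = 0. Proof. by case: b. Qed.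

Lemma flipN b v : flip b (- v) = - flip b v. Proof. by case: b. Qed.

Lemma flipD b v w : flip b (v + w) = flip b v + flip b w.
Proof. by case: b. Qed.

Lemma flipM b b' v : flip b (flip b' v) = flip (b (+) b') v.
Proof. by case: b; case: b'; case: v. Qed.

Lemma flipK b : involutive (flip b).
Proof. by move=> v; rewrite flipM addbb. Qed.

Lemma apartC u v : apart u v = apart v u.
Proof. by rewrite /apart eq_sym (eq_sym u.2). Qed.

Lemma apart_flip b u v : apart (flip b u) (flip b v) = apart u v.
Proof. by case: b; rewrite /apart //= andbC. Qed.

Lemma apartDr w u v : apart (u + w) (v + w) = apart u v.
Proof. by rewrite /apart /= !(inj_eq (addIr _)). Qed.

Lemma apart_sub u v : apart (u - v) 0 = apart u v.
Proof. by rewrite -(apartDr v) subrK add0r. Qed.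

Lemma apartN0 u : apart (- u) 0 = apart u 0.
Proof. by rewrite /apart /= !oppr_eq0. Qed.

(** Uses that there are at least three residues: each is a sum of two nonzero
    ones. *)
Lemma apart_sum v : exists u w, [/\ apart u 0, apart w 0 & v = u + w].
Proof.
have split1 (a : 'I_n.+3) : exists2 x, x != 0 & a - x != 0.
  case: (eqVneq a 1) => [->|a1]; last by exists 1; rewrite ?oner_eq0 ?subr_eq0.
  exists (1 + 1); first by rewrite -val_eqE.
  by rewrite opprD addrA subrr sub0r oppr_eq0 oner_eq0.
have [x x0 vx] := split1 v.1; have [y y0 vy] := split1 v.2.
exists (x, y), (v - (x, y)); split; first by rewrite /apart x0.
  by rewrite /apart /= vx.
by rewrite addrC subrK.
Qed.

End Torus.

Definition oddz (i : int) := odd `|i|.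

Lemma oddzD i j : oddz (i + j) = oddz i (+) oddz j.
Proof. by rewrite /oddz; lia. Qed.

Lemma oddzN i : oddz (- i) = oddz i.
Proof. by rewrite /oddz abszN. Qed.

(** The pair [(v, i)] stands for the product of [v] and the [i]-th power of the
    generator [t] of the integers; [b] tells whether [t] acts by exchanging the
    coordinates. *)
Definition torus_by_Z (b : bool) (n : nat) : Type := (torus n * int)%type.

Section TorusByZ.
Variables (b : bool) (n : nat).
Local Notation G := (torus_by_Z b n).
Implicit Types g h : G.

Definition act (i : int) : torus n -> torus n := flip (b && oddz i).

Lemma actD i j v : act (i + j) v = act i (act j v).
Proof. by rewrite /act flipM oddzD; case: b. Qed.

Lemma actN i : act (- i) = act i. Proof. by rewrite /act oddzN. Qed.

Lemma actK i : involutive (act i). Proof. exact: flipK. Qed.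

Definition tz_mul g h : G := (g.1 + act g.2 h.1, g.2 + h.2).
Definition tz_inv g : G := (- act g.2 g.1, - g.2).
Definition tz_one : G := (0, 0).

Lemma tz_mulA : associative tz_mul.
Proof.
move=> g h k; rewrite /tz_mul /= addrA; congr (_, _).
by rewrite actD {1}/act flipD addrA.
Qed.

Lemma tz_mul1 : left_id tz_one tz_mul.
Proof. by case=> v i; rewrite /tz_mul /= !add0r /act andbF. Qed.

Lemma tz_mulr1 : right_id tz_one tz_mul.
Proof. by case=> v i; rewrite /tz_mul /= {1}/act flip0 !addr0. Qed.

Lemma tz_mulVg : left_inverse tz_one tz_inv tz_mul.
Proof. by case=> v i; rewrite /tz_mul /= actN !addNr. Qed.

Lemma tz_mulgV : right_inverse tz_one tz_inv tz_mul.
Proof.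
by case=> v i; rewrite /tz_mul /= {1}/act flipN -/(act _ _) actK !subrr.
Qed.

HB.instance Definition _ := Countable.on (torus_by_Z b n).
HB.instance Definition _ := isGroup.Build (torus_by_Z b n)
  tz_mulA tz_mul1 tz_mulr1 tz_mulVg tz_mulgV.

Lemma tz_mulE g h : (g * h)%g = (g.1 + act g.2 h.1, g.2 + h.2) :> G.
Proof. by []. Qed.

Lemma tz_invE g : (g^-1)%g = (- act g.2 g.1, - g.2) :> G.
Proof. by []. Qed.

Definition tz_gens : set G := [set g | apart g.1 0 /\ (`|g.2| <= 1)%N].

Lemma tz_gens_finite : finite_set tz_gens.
Proof.
apply: (@sub_finite_set _ _ ([set: torus n] `*` [set` [:: -1; 0; 1 : int]])).
  by case=> v i [_ /= i1]; split=> //=; rewrite !inE; lia.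
by apply: finite_setX; [exact: finite_finset|exact: finite_seq].
Qed.

Lemma tz_gensV g : tz_gens g -> tz_gens (g^-1)%g.
Proof.
case=> g1 g2; split; rewrite tz_invE /=; last by rewrite abszN.
by rewrite apartN0 -(flip0 _ (b && oddz g.2)) apart_flip.
Qed.

Lemma tz_gens1 : ~ tz_gens 1%g.
Proof. by case=> /andP[/eqP[]]. Qed.

Lemma tz_gens_generate (H : set G) : H 1%g ->
  (forall g h, H g -> H h -> H (g * h)%g) -> (forall g, H g -> H (g^-1)%g) ->
  tz_gens `<=` H -> H = setT.
Proof.
move=> H1 HM HV SH; rewrite -subTset => -[v i] _.
have H0 w : H (w, 0).
  have [u [u' [u0 u'0 ->]]] := apart_sum w.
  have -> : ((u + u', 0) : G) = (((u, 0) : G) * ((u', 0) : G))%g.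
    by rewrite tz_mulE /= addr0 /act andbF.
  by apply: HM; apply: SH; split.
have Ht : H (0, 1).
  have -> : ((0, 1) : G) =
      (((- (1, 1) : torus n, 0)%R : G) * (((1, 1) : torus n, 1)%R : G))%g.
    by rewrite tz_mulE /= add0r /act andbF /= addNr.
  by apply: HM => //; apply: SH; split.
have Hi : H (0, i).
  elim/int_rect: i => [|i IH|i IH]; first exact: H0.
    have -> : ((0, i.+1%:Z) : G) = (((0, i%:Z) : G) * ((0, 1)%R : G))%g.
      by rewrite tz_mulE /= /act flip0 addr0 -[i.+1]addn1 PoszD.
    exact: HM.
  have -> : ((0, - i.+1%:Z) : G) = (((0, - i%:Z) : G) * ((0, 1)%R : G)^-1)%g.
    by rewrite tz_invE tz_mulE /= /act !flip0 oppr0 flip0 addr0 -[i.+1]addn1 PoszD opprD.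
  by apply: HM => //; exact: HV.
have -> : ((v, i) : G) = (((v, 0) : G) * ((0, i) : G))%g.
  by rewrite tz_mulE /= /act flip0 addr0 add0r.
exact: HM.
Qed.

Definition tz_marked : markedGroup :=
  MarkedGroup tz_gens_finite tz_gensV tz_gens1 tz_gens_generate.

Lemma tz_countable : countable [set: tz_marked].
Proof. exact: (@countableP G). Qed.

Lemma tz_large (W : seq tz_marked) :
  exists N, forall v (i : int), (N <= `|i|)%N -> (v, i) \notin W.
Proof.
exists (\max_(w <- W) `|(w : G).2|).+1 => v i Ni; apply/negP => viW.
have := @leq_bigmax_seq _ W xpredT (fun w : G => `|w.2|%N) (v, i) viW isT.
by rewrite leqNgt Ni.
Qed.

Lemma tz_infinite (W : seq tz_marked) : exists h, h \notin W.
Proof. by have [N NP] := tz_large W; exists (0, N%:Z); exact: NP. Qed.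

End TorusByZ.

(** Exchanging the coordinates at all odd heights removes the twist, because
    the set of generators is invariant under this exchange. *)
Lemma tz_cayley_isomorphic n :
  graph_isomorphic (cayley_graph (tz_marked true n)) (cayley_graph (tz_marked false n)).
Proof.
exists (fun g => (flip (oddz g.2) g.1, g.2)).
  by exists (fun g => (flip (oddz g.2) g.1, g.2)) => -[v i] /=; rewrite flipK.
case=> v i [w j]; split.
  case=> -[s e] [/= s0 e1] [<- <-].
  exists (flip (oddz (e + i)) s, e).
    by split=> //=; rewrite -(flip0 _ (oddz (e + i))) apart_flip.
  by rewrite /= tz_mulE /= /act /= flipD flipM oddzD; case: (oddz e); case: (oddz i).
case=> -[s e] [/= s0 e1] [ws es].
exists (flip (oddz (e + i)) s, e).
  by split=> //=; rewrite -(flip0 _ (oddz (e + i))) apart_flip.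
rewrite /= tz_mulE /= /act /=; congr (_, _) => //.
rewrite -[RHS](flipK (oddz j)) -ws -es /act /= flipD flipM oddzD.
by case: (oddz e); case: (oddz i).
Qed.

(** * Lower bounds *)

Section GridColorings.
Variables (n k : nat).
Implicit Types (f g : torus n -> 'I_k) (y : 'I_k) (a : 'I_n.+3).

Definition compatible f g := forall v w, apart v w -> f v <> g w.

(** The color [y] occurs at least twice in row [a], in the form that is
    convenient to use: some cell of color [y] avoids any given column. *)
Definition row_color f a y := forall b0, exists2 b, b != b0 & f (a, b) = y.

Definition row_type f := forall a, exists y, row_color f a y.

Definition col_type f := row_type (f \o flip true).

Lemma compatible_sym f g : compatible f g -> compatible g f.
Proof. by move=> fg v w; rewrite apartC => /fg /nesym. Qed.

Lemma compatible_flip f g :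
  compatible f g -> compatible (f \o flip true) (g \o flip true).
Proof. by move=> fg v w vw; apply: fg; rewrite apart_flip. Qed.

Lemma flip_flip f : f \o flip true \o flip true = f.
Proof. by apply/funext => v /=; case: v. Qed.

(** A cell of color [y] outside of row [a] would be apart from one of the two
    cells of color [y] in row [a]. *)
Lemma row_color_only f g a y v :
  compatible f g -> row_color f a y -> g v = y -> v.1 = a.
Proof.
move=> fg fay gv; have [b bv fab] := fay v.2.
have [//|va] := eqVneq v.1 a.
by case: (fg (a, b) v); rewrite ?fab ?gv // /apart /= eq_sym va.
Qed.

Lemma not_row_type f : ~ row_type f ->
  exists a, injective (fun b => f (a, b)).
Proof.
move=> /existsNP [a Ha]; exists a => b b' fbb'; apply: contrapT => /eqP bb'.
apply: Ha; exists (f (a, b)) => b0.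
by have [<-|?] := eqVneq b b0; [exists b'; rewrite // eq_sym|exists b].
Qed.

(** A row without repeated colors and a column without repeated colors form a
    cross of [2 (n + 3) - 1] cells whose colors are all distinct. *)
Lemma row_or_col f : (k < (n.+3 + n.+3).-1)%N -> compatible f f ->
  row_type f \/ col_type f.
Proof.
move=> kn ff; apply: contrapT => /not_orP [/not_row_type [a fa]].
move=> /not_row_type [b fb] /=.
pose h (s : 'I_n.+3 + 'I_n.+2) :=
  match s with inl j => f (a, j) | inr i => f (lift a i, b) end.
have hinj : injective h.
  have cross j i : f (a, j) <> f (lift a i, b).
    have [-> /(fb a (lift a i))/eqP|jb] := eqVneq j b.
      by rewrite (negPf (neq_lift _ _)).
    by apply: ff; rewrite /apart /= neq_lift.
  move=> [j|i] [j'|i'] /= => [/fa->//|/cross//|/esym/cross//|].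
  by move=> /(fb (lift a i) (lift a i')) /lift_inj ->.
have := leq_card h hinj; rewrite card_sum !card_ord.
by move: kn; lia.
Qed.

(** Choosing a repeated color in each row of [f] and in each column of [g] gives
    [2 (n + 3)] distinct colors. *)
Lemma row_col_clash f g : (k < n.+3 + n.+3)%N ->
  compatible f f -> compatible g g -> compatible f g ->
  row_type f -> col_type g -> False.
Proof.
move=> kn ff gg fg /choice [r rP] /choice [s sP].
pose h (i : 'I_n.+3 + 'I_n.+3) := match i with inl a => r a | inr b => s b end.
have cross a b : r a <> s b.
  move=> e; have [a' a'a gs] := sP b a.
  move: a'a; rewrite (_ : a' = a) ?eqxx //.
  by apply: (row_color_only (v := (a', b)) fg (rP a)); rewrite e.
have hinj : injective h.
  move=> [a|b] [a'|b'] /= => [e|/cross//|/esym/cross//|e]; congr (_ _).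
    have [b _ fab] := rP a a.
    by apply: (row_color_only (v := (a, b)) ff (rP a')); rewrite -e.
  have [a _ fab] := sP b b.
  apply: (row_color_only (v := (b, a)) (compatible_flip gg) (sP b')).
  by rewrite -e.
have := leq_card h hinj; rewrite card_sum !card_ord.
by rewrite leqNgt kn.
Qed.

(** With no more colors than rows, the repeated colors of the rows exhaust all
    colors, so that each color is confined to its row, in [g] as well as in
    [f]. *)
Lemma compatible_rigid_row f g : (k <= n.+3)%N ->
  compatible f f -> compatible f g -> row_type f -> f =1 g.
Proof.
move=> kn ff fg /choice [r rP].
have rinj : injective r.
  move=> a a' e; have [b _ fab] := rP a a.
  by apply: (row_color_only (v := (a, b)) ff (rP a')); rewrite -e.
have rsurj y : exists a, y = r a.
  by apply/codomP; apply: inj_card_onto => //; rewrite !card_ord.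
have row h v : compatible f h -> h v = r v.1.
  move=> fh; have [a hv] := rsurj (h v).
  by rewrite {1}hv (row_color_only fh (rP a) hv).
by move=> v; rewrite !row.
Qed.

Lemma compatible_rigid f g : (k <= n.+3)%N ->
  compatible f f -> compatible f g -> f =1 g.
Proof.
move=> kn ff fg; have [|fr|fc] := @row_or_col f _ ff; first by lia.
  exact: compatible_rigid_row.
move=> v; rewrite -(flip_flip f) -(flip_flip g).
exact: (compatible_rigid_row kn (compatible_flip ff) (compatible_flip fg) fc).
Qed.

End GridColorings.

Section Slices.
Variables (b : bool) (n k : nat).
Local Notation Gamma := (tz_marked b n).
Variable c : free_part Gamma -> 'I_k.
Hypothesis cP : coloring (shift_graph Gamma) c.

Definition tz_elt v i : Gamma := (v, i).

Definition slice (z : free_part Gamma) (v : torus n) : 'I_k :=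
  c (free_shift (tz_elt v 0) z).

Lemma tz_eltM v i w j :
  (tz_elt v i * tz_elt w j)%g = tz_elt (v + act b i w) (i + j).
Proof. by []. Qed.

Lemma tz_edge z v w (e : int) : (`|e| <= 1)%N -> apart (act b e v) w ->
  shift_graph Gamma (free_shift (tz_elt v 0) z) (free_shift (tz_elt w e) z).
Proof.
move=> e1 vw; apply/shift_graphP; exists (tz_elt (w - act b e v) e).
  by split => //=; rewrite apart_sub apartC.
by rewrite -free_shiftM tz_eltM subrK addr0.
Qed.

Lemma slice_compatible z : compatible (slice z) (slice z).
Proof.
move=> v w vw; apply: cP; apply: tz_edge => //.
by rewrite /act andbF.
Qed.

Definition step : free_part Gamma -> free_part Gamma := free_shift (tz_elt 0 1).

(** Passing to the next height exchanges the coordinates in the twisted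
    group. *)
Lemma slice_step z : compatible (slice z \o flip b) (slice (step z)).
Proof.
move=> v w vw; rewrite /= /slice /step -free_shiftM tz_eltM add0r /act andbF addr0.
apply: cP; apply: tz_edge => //.
by rewrite /act andbT flipK.
Qed.

Lemma iter_step N z : iter N step z = free_shift (tz_elt 0 N%:Z) z.
Proof.
elim: N => [|N IH] /=; first by rewrite free_shift1.
by rewrite IH /step -free_shiftM tz_eltM add0r /act flip0 -PoszD.
Qed.

End Slices.

Section LowerBounds.
Variables (R : realType) (n k : nat).

(** Recurrence for the element [u t^N] with [N] odd and large, applied to all
    colors of a slice simultaneously. *)
Lemma slices_recur b (c : free_part (tz_marked b n) -> 'I_k) u :
  (forall i, baire_property (c @^-1` [set i])) ->
  exists N, exists2 z, odd N &
    slice c z =1 (fun v => slice c (iter N (@step b n) z) (v + u)).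
Proof.
move=> bc; have [W WP] := generic_recurrence [seq tz_elt b v 0 | v <- enum {: torus n}]
  (tz_countable b n) (@tz_infinite b n) bc.
have [N0 N0P] := tz_large W.
pose N := (N0.*2.+1)%N.
have [z zP] := WP (tz_elt b u N%:Z) (N0P u N%:Z ltac:(rewrite /N; lia)).
exists N, z; first by rewrite /N /= odd_double.
move=> v; rewrite /slice zP; last by apply: map_f; rewrite mem_enum.
by rewrite iter_step -free_shiftM !tz_eltM /act andbF /= addr0.
Qed.

(** With fewer colors, each step of [t] exchanges row type and column type,
    against the recurrence of a slice after an odd number of steps. *)
Lemma twisted_lower :
  baire_colorable R (shift_graph (tz_marked true n)) k -> (n + n + 5 <= k)%N.
Proof.
move=> /baire_colorableP [c cP bc]; rewrite leqNgt; apply/negP => kn.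
have [N [z oN zP]] := slices_recur 0 bc.
have ff z' : compatible (slice c z') (slice c z') by exact: slice_compatible.
have kn1 : (k < (n.+3 + n.+3).-1)%N by lia.
have kn2 : (k < n.+3 + n.+3)%N by lia.
have swap z' : row_type (slice c (@step true n z')) <-> ~ row_type (slice c z').
  have gg := @compatible_flip _ _ _ _ (ff z'); have gf := @slice_step _ _ _ c cP z'.
  split=> [r1 r0|nr].
    apply: (row_col_clash kn2 (ff _) gg (@compatible_sym _ _ _ _ gf) r1).
    by rewrite /col_type flip_flip.
  have [//|cc] := row_or_col kn1 (ff (step z')).
  have [//|c0] := row_or_col kn1 (ff z').
  by case: (row_col_clash kn2 gg (ff _) gf c0 cc).
have iters j : row_type (slice c (iter j (@step true n) z)) <->
    (if odd j then ~ row_type (slice c z) else row_type (slice c z)).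
  elim: j => [|j IH] //=; rewrite swap IH; case: (odd j) => //=.
  by split=> [|r nr]; [exact: contrapT|exact: nr].
have zN : slice c (iter N (@step true n) z) = slice c z.
  by apply/funext => v; rewrite zP addr0.
have := iters N; rewrite oN zN => -[r0 nr0].
by have nr : ~ row_type (slice c z) by [move=> r; exact: (r0 r)]; exact: nr (nr0 nr).
Qed.

(** With fewer colors, the slices do not change along [t], so that recurrence up
    to the translation by [(1, 1)] gives the same color to two adjacent
    points. *)
Lemma untwisted_lower :
  baire_colorable R (shift_graph (tz_marked false n)) k -> (n + 4 <= k)%N.
Proof.
move=> /baire_colorableP [c cP bc]; rewrite leqNgt; apply/negP => kn.
have [N [z _ zP]] := slices_recur (1, 1) bc.
have stepE z' : slice c z' =1 slice c (@step false n z').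
  apply: compatible_rigid; [by lia|exact: slice_compatible|].
  exact: (@slice_step _ _ _ c cP z').
have iters j : slice c z =1 slice c (iter j (@step false n) z).
  by elim: j => [|j IH] // v; rewrite iterS -stepE IH.
by apply: (@slice_compatible _ _ _ c cP z 0 (1, 1)) => //; rewrite zP -iters add0r.
Qed.

End LowerBounds.

(** * Colorings interpolating between markers *)

(** Here [path d j] is the coloring of the slice [j] steps above a marker, when
    the next marker is obtained from this one by applying [d].  Cells are named
    after untwisted coordinates: [u] is the cell [t^j u x] above the marker [x].
    In these coordinates, the coloring [start] of the slice of the next marker,
    counted from there, is the one in the hypothesis [path_end]. *)
Section ColoringOfPaths.
Variables (b : bool) (n k N : nat).
Local Notation Gamma := (tz_marked b n).
Local Notation ht g := ((g : torus_by_Z b n).2).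
Local Notation pos g := ((g : torus_by_Z b n).1).
Local Notation X := {ptws Gamma -> bool}.
Variables (start : torus n -> 'I_k) (path : Gamma -> nat -> torus n -> 'I_k).
Hypothesis path0 : forall d u, path d 0 u = start u.
Hypothesis path_end : forall d j u, (N <= j)%N ->
  path d j u = start (act b (ht d) u - pos d).
Hypothesis path_stay : forall d j, compatible (path d j) (path d j).
Hypothesis path_move : forall d j, compatible (path d j) (path d j.+1).

Implicit Types (g h : Gamma) (x : X) (z : free_part Gamma).

Definition heights : seq int := [seq j%:Z - N%:Z | j <- iota 0 N.*2.+1].

Lemma mem_heights i : (i \in heights) = (`|i| <= N)%N.
Proof.
apply/mapP/idP => [[j + ->]|iN]; first by rewrite mem_iota; lia.
by exists (absz (i + N%:Z)); rewrite ?mem_iota; lia.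
Qed.

Definition window : seq Gamma :=
  [seq tz_elt b v i | v <- enum {: torus n}, i <- heights].

Lemma mem_window g : (g \in window) = (`|ht g| <= N)%N.
Proof.
case: g => v i; rewrite -mem_heights /=; apply/allpairsP/idP => /=.
  by case=> -[w j] [_ /= jN [_ ->]].
by move=> iN; exists (v, i); split=> //=; rewrite mem_enum.
Qed.

Section Marked.
Variable M : set X.
Hypothesis openM : open M.
Hypothesis M_discrete : forall x g,
  M x -> g \in window -> M (shift g x) -> g = 1%g.
Hypothesis M_maximal : forall x, free_part Gamma x ->
  exists2 g, g \in window & M (shift g x).

Lemma mark_eq x g h : M (shift g x) -> M (shift h x) ->
  (`|ht h - ht g| <= N)%N -> h = g.
Proof.
move=> Mg Mh hg; apply: (mulIg (g^-1)%g); rewrite mulgV.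
by apply: (M_discrete Mg); rewrite ?mem_window // -shiftM mulgVK.
Qed.

Lemma mark_separated x g h : M (shift g x) -> M (shift h x) ->
  ht h = ht g \/ (N < `|ht h - ht g|)%N.
Proof.
move=> Mg Mh; have [gh|] := leqP `|ht h - ht g| N; last by right.
by left; rewrite (mark_eq Mg Mh gh).
Qed.

Lemma mark_near x (i : int) : free_part Gamma x ->
  exists g, M (shift g x) /\ (`|ht g - i| <= N)%N.
Proof.
move=> Fx; have [g gN Mg] := M_maximal (@free_part_shift _ (tz_elt b 0 i) _ Fx).
exists (g * tz_elt b 0 i)%g; rewrite shiftM; split=> //=.
by move: gN; rewrite mem_window; lia.
Qed.

(** The marker at or below [x] and the next one above it.  Distinct markers
    differ in height by more than [N], so a gap of at most [2 N + 1] cannot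
    contain a third one. *)
Definition bracket x g h := [/\ M (shift g x), M (shift h x),
  ht g <= 0, 0 < ht h & ht h - ht g <= (N.*2.+1)%:Z].

(** Take the highest marker at or below height 0.  Maximality, applied [N + 1]
    levels above it, gives a marker that is higher than it by at most
    [2 N + 1], hence one above height 0. *)
Lemma bracket_exists x : free_part Gamma x -> exists gh : Gamma * Gamma,
  bracket x gh.1 gh.2.
Proof.
move=> Fx.
pose P j := `[< exists g, M (shift g x) /\ ht g = - j%:Z >].
have exP : exists j, P j.
  have [g [Mg gN]] := mark_near (- N%:Z) Fx.
  by exists `|ht g|%N; apply/asboolP; exists g; split=> //; lia.
have [j /asboolP [g [Mg gj]] jmin] := ex_minnP exP.
have [h [Mh hN]] := mark_near (ht g + N.+1%:Z) Fx.
exists (g, h); split=> //=; [lia| |lia].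
rewrite ltNge; apply/negP => h0.
have := jmin `|ht h|%N; rewrite leqNgt => H.
have : ~~ (`|ht h| < j)%N by apply: H; apply/asboolP; exists h; split=> //; lia.
lia.
Qed.

(** The upper bound on the gap leaves no room for two candidates. *)
Lemma bracket_first x g h g' : bracket x g h -> M (shift g' x) ->
  ht g' <= 0 -> ht h - ht g' <= (N.*2.+1)%:Z -> g' = g.
Proof.
case=> Mg Mh g0 h0 hg Mg' g'0 hg'.
have gg' := mark_separated Mg Mg'.
have hgs := mark_separated Mg Mh; have hgs' := mark_separated Mg' Mh.
by apply: (mark_eq Mg Mg'); lia.
Qed.

Lemma bracket_unique x g h g' h' : bracket x g h -> bracket x g' h' ->
  g' = g /\ h' = h.
Proof.
case=> Mg Mh g0 h0 hg [Mg' Mh' g'0 h'0 hg'].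
have s1 := mark_separated Mg Mg'; have s2 := mark_separated Mh Mh'.
have s3 := mark_separated Mg Mh; have s4 := mark_separated Mg' Mh'.
have s5 := mark_separated Mg Mh'; have s6 := mark_separated Mg' Mh.
by split; [apply: (mark_eq Mg Mg')|apply: (mark_eq Mh Mh')]; lia.
Qed.

Definition bracket_color g h := path (h * g^-1)%g `|ht g|%N (- pos g).

Definition bracket_of z : Gamma * Gamma :=
  projT1 (cid (bracket_exists (set_valP z))).

Lemma bracket_ofP z : bracket (set_val z) (bracket_of z).1 (bracket_of z).2.
Proof. by rewrite /bracket_of; case: (cid _). Qed.

Definition marker_color z := bracket_color (bracket_of z).1 (bracket_of z).2.

Lemma marker_colorE z g h : bracket (set_val z) g h ->
  marker_color z = bracket_color g h.
Proof.
by move=> zgh; rewrite /marker_color; have [-> ->] := bracket_unique zgh (bracket_ofP z).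
Qed.

(** The color depends only on which two translates of the point are markers, and
    being a marker is an open condition. *)
Lemma open_marker_color i : open (marker_color @^-1` [set i]).
Proof.
rewrite openE => z zi; have zP := bracket_ofP z.
set g := (bracket_of z).1 in zP; set h := (bracket_of z).2 in zP.
pose V : set (free_part Gamma) :=
  set_val @^-1` (shift g @^-1` M `&` shift h @^-1` M).
apply: (@filterS _ _ _ V).
  move=> z' [Mg Mh] /=; rewrite -zi /marker_color -/g -/h.
  apply: marker_colorE; by case: zP.
apply: open_nbhs_nbhs; split; last by case: zP.
exists (shift g @^-1` M `&` shift h @^-1` M) => //.
by apply: openI; exact: open_shift.
Qed.

Lemma start_proper : compatible start start.
Proof. by move=> u u' uu'; rewrite -!(path0 1%g); exact: path_stay. Qed.

Lemma mark_shift x g s : M (shift (g * s^-1)%g (shift s x)) = M (shift g x).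
Proof. by rewrite -shiftM mulgVK. Qed.

Lemma apart_divr g (s : Gamma) : gens Gamma s ->
  apart (- pos g) (- pos (g * s^-1)%g).
Proof.
case=> s0 _; rewrite tz_mulE tz_invE /= opprD -[X in apart X _]add0r.
rewrite [- _ - _]addrC apartDr apartC apartN0 /act flipN apartN0.
by rewrite flipM -(flip0 _ ((b && oddz (ht g)) (+) (b && oddz (ht s)))) apart_flip.
Qed.

(** Either both endpoints lie between the same two markers, where the path is
    proper, or the upper one is at the height of a marker; the path below that
    marker has already reached the coloring [start] counted from it. *)
Lemma marker_color_edge z s : gens Gamma s -> ht s = 0 \/ ht s = 1 ->
  marker_color z <> marker_color (free_shift s z).
Proof.
move=> Ss s01; have := bracket_ofP z.
move: (bracket_of z) (@marker_colorE z) => [g h] /= zE /[dup] zgh [Mg Mh g0 h0 hg].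
rewrite (zE _ _ zgh); have gs := apart_divr g Ss; have hs := apart_divr h Ss.
have htV g1 : ht (g1 * s^-1)%g = ht g1 - ht s by [].
have [sh|sh] := ltP (ht s) (ht h).
  have zgh' : bracket (set_val (free_shift s z)) (g * s^-1)%g (h * s^-1)%g.
    by split; rewrite ?mark_shift // ?htV; lia.
  rewrite (marker_colorE zgh') /bracket_color invgM invgK mulgA mulgVK htV.
  case: s01 => ->; first by rewrite subr0; exact: path_stay.
  rewrite (_ : `|ht g - 1| = `|ht g|.+1)%N; [exact: path_move|lia].
have [s1 h1] : ht s = 1 /\ ht h = 1 by lia.
have z' := bracket_ofP (free_shift s z); have [_ Mh'' g0'' h0'' hg''] := z'.
have hE : (h * s^-1)%g = (bracket_of (free_shift s z)).1.
  have Mhs : M (shift (h * s^-1)%g (set_val (free_shift s z))).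
    by rewrite mark_shift.
  have h0s : ht (h * s^-1)%g = 0 by rewrite htV s1 h1.
  by apply: (bracket_first z') => //; lia.
rewrite /marker_color -hE {2}/bracket_color htV s1 h1 subrr path0 /bracket_color.
have Ng : (N <= `|ht g|)%N by have := mark_separated Mg Mh; lia.
rewrite path_end //.
suff -> : act b (ht (h * g^-1)%g) (- pos g) - pos (h * g^-1)%g = - pos h.
  exact: start_proper.
rewrite tz_mulE tz_invE /= actD actN {2}/act flipN -/(act _ _ _) opprD addrCA.
by rewrite subrr addr0.
Qed.

End Marked.

(** If [start] can be deformed within [N] proper steps into each of its
    translates that can occur at the next marker, then the shift graph has a
    continuous coloring. *)
Lemma coloring_of_paths : exists2 c : free_part Gamma -> 'I_k,
  coloring (shift_graph Gamma) c & forall i, open (c @^-1` [set i]).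
Proof.
have [| |M [oM dM mM]] := @exists_markers Gamma window (tz_countable b n).
- by rewrite mem_window.
- by move=> g; rewrite !mem_window abszN.
exists (marker_color mM); last exact: (open_marker_color oM dM).
have edge := marker_color_edge dM (M_maximal := mM).
move=> z z' /shift_graphP [s Ss <-].
have [s01|s1] : (ht s = 0 \/ ht s = 1) \/ ht s = -1.
- by case: (Ss) => _; lia.
- exact: edge.
have sV : ht (s^-1)%g = 1 by rewrite tz_invE /= s1.
have := edge (free_shift s z) (s^-1)%g (gensV Ss) (or_intror sV).
by rewrite -free_shiftM mulVg free_shift1 => /nesym.
Qed.

End ColoringOfPaths.

(** * Upper bounds and conclusion *)

Lemma modn_neq d a c : (a < c)%N -> (c - a < d)%N -> (a %% d)%N <> (c %% d)%N.
Proof.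
move=> ac cad /esym/eqP; rewrite eqn_mod_dvd ?(ltnW ac) // => /dvdn_leq.
by rewrite subn_gt0 ac leqNgt cad => /(_ isT).
Qed.

Section Sliding.
Variable m : nat.

(** Position, modulo [m + 2], at time [J] of the particle that starts at site [i]
    among [m + 1] particles on a cycle of [m + 2] sites, when the particle just
    behind the unique hole moves into it at each unit of time. *)
Definition sliding (J i : nat) := (i + (i + J) %/ m.+1)%N.

Lemma sliding_neq J J' i i' : (i < m.+1)%N -> (i' < m.+1)%N -> i <> i' ->
  (J <= J' <= J.+1)%N ->
  (sliding J i %% m.+2)%N <> (sliding J' i' %% m.+2)%N.
Proof.
move=> im i'm ii' /andP[JJ' J'J].
have div_le a c : (a <= c <= a + m.+1 -> a %/ m.+1 <= c %/ m.+1 <= (a %/ m.+1).+1)%N.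
  move=> /andP[ac ca]; rewrite leq_div2r //=.
  by apply: leq_trans (leq_div2r _ ca) _; rewrite divnDr // divnn addn1.
have [lt|lt|//] := ltngtP i i'.
  have := div_le (i + J)%N (i' + J')%N ltac:(lia).
  by move=> ?; apply: modn_neq; rewrite /sliding; lia.
have := div_le (i' + J')%N (i + J)%N ltac:(lia).
by move=> ?; apply/nesym/modn_neq; rewrite /sliding; lia.
Qed.

Lemma sliding0 i : (i < m.+1)%N -> sliding 0 i = i.
Proof. by move=> im; rewrite /sliding addn0 divn_small ?addn0. Qed.

(** After [s (m + 2)] moves the hole is back at its site, and the particles are
    rotated by [s] among the remaining ones. *)
Lemma sliding_turn s i : (i < m.+1)%N -> (s < m.+1)%N ->
  (sliding (s * m.+2) i %% m.+2)%N = ((i + s) %% m.+1)%N.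
Proof.
move=> im sm; rewrite /sliding.
have -> : (i + s * m.+2 = s * m.+1 + (i + s))%N by nia.
rewrite divnMDl //; have [lt|ge] := ltnP (i + s) m.+1.
  by rewrite divn_small // addn0 !modn_small //; lia.
have -> : (i + s = (i + s - m.+1) + m.+1)%N by lia.
rewrite divnDr // divnn modnDr divn_small; last by lia.
rewrite (_ : (i + _)%N = (i + s - m.+1) + m.+2)%N; last by lia.
by rewrite modnDr !modn_small; lia.
Qed.

End Sliding.

Lemma untwisted_coloring n : exists2 c : free_part (tz_marked false n) -> 'I_(n + 4),
  coloring (shift_graph (tz_marked false n)) c & forall i, open (c @^-1` [set i]).
Proof.
rewrite addn4.
pose off (d : tz_marked false n) : 'I_n.+3 := - (d : torus_by_Z false n).1.1.
(* The rotation is by [off d], and takes [off d * n.+4] units of time. *)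
pose time (d : tz_marked false n) (j : nat) := minn j (off d * n.+4).
pose path d j (u : torus n) : 'I_n.+4 := inZp (sliding n.+2 (time d j) u.1).
have sliding_compat d j j' : (j <= j' <= j.+1)%N -> compatible (path d j) (path d j').
  move=> jj' u u' /andP[/eqP uu' _] /(congr1 val) /=; apply: sliding_neq => //.
    by move=> /val_inj.
  by rewrite /time; lia.
apply: (@coloring_of_paths false n n.+4 (n.+3 * n.+4) (fun u => inZp u.1) path).
- by move=> d u; rewrite /path /time min0n sliding0.
- move=> d j u Nj; apply/val_inj; rewrite /path /time /=.
  have od := ltn_ord (off d).
  have -> : minn j (off d * n.+4) = (off d * n.+4)%N.
    by apply/minn_idPr; apply: (leq_trans _ Nj); rewrite leq_mul2r ltnW ?orbT.
  rewrite sliding_turn //= /off [RHS]modn_small //.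
  by apply: (leq_trans (ltn_pmod _ _)).
- by move=> d j; apply: sliding_compat; lia.
- by move=> d j; apply: sliding_compat; lia.
Qed.

(** From the coloring by rows to any proper coloring [target] with the same
    colors: all columns but the first get additional colors of their own, then
    the first column changes to its target colors, then the other ones do. *)
Lemma twisted_coloring n : exists2 c : free_part (tz_marked true n) -> 'I_(n + n + 5),
  coloring (shift_graph (tz_marked true n)) c & forall i, open (c @^-1` [set i]).
Proof.
have -> : (n + n + 5 = (n + n + 4).+1)%N by lia.
pose target (d : tz_marked true n) (u : torus n) : torus n :=
  act true (d : torus_by_Z true n).2 u - (d : torus_by_Z true n).1.
pose path (d : tz_marked true n) j (u : torus n) : nat := match j with
  | 0 => u.1
  | 1 => if u.2 == 0 then (u.1 : nat) else (n.+2 + u.2)%N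
  | 2 => if u.2 == 0 then ((target d u).1 : nat) else (n.+2 + u.2)%N
  | _ => (target d u).1
  end.
have target_apart d u u' : apart u u' -> ((target d u).1 <> (target d u').1 :> nat).
  move=> uu' /val_inj/eqP; apply/negP.
  have : apart (target d u) (target d u') by rewrite apartDr apart_flip.
  by case/andP.
have small (a : 'I_n.+3) : (a < n.+3)%N by [].
have path_lt d j u : (path d j u < (n + n + 4).+1)%N.
  have := small u.1; have := small u.2; have := small (target d u).1.
  by case: j => [|[|[|j]]] /=; do ?[case: ifP]; lia.
have path_apart d j j' u u' :
    (j <= j' <= j.+1)%N -> apart u u' -> path d j u <> path d j' u'.
  move=> jj' uu'; have tt := target_apart d _ _ uu'.
  have /andP[/eqP u1 /eqP u2] := uu'.
  have v1 : (u.1 : nat) <> u'.1 by move=> /val_inj.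
  have v2 : (u.2 : nat) <> u'.2 by move=> /val_inj.
  have eq0 (a : 'I_n.+3) : (a == 0) = (a == 0%N :> nat) by [].
  rewrite /path; move: (target d u) (target d u') tt => t t' tt.
  have := small u.1; have := small u'.1; have := small t.1; have := small t'.1.
  by case: j jj' => [|[|[|j]]]; case: j' => [|[|[|j']]] //= jj';
    rewrite ?eq0; do 2?[case: eqP => ?]; lia.
pose color d j u : 'I_(n + n + 4).+1 := inord (path d j u).
have color_apart d j j' : (j <= j' <= j.+1)%N -> compatible (color d j) (color d j').
  move=> jj' u u' uu' /(congr1 val); rewrite /= !inordK //; exact: path_apart.
apply: (@coloring_of_paths true n (n + n + 4).+1 3 (fun u => inord u.1) color) => //.
- by move=> d [|[|[|j]]].
- by move=> d j; apply: color_apart; lia.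
- by move=> d j; apply: color_apart; lia.
Qed.

Section ChromaticNumbers.
Variables (R : realType) (X : topologicalType) (G : graph X) (n : nat).
Hypothesis lower : forall k, baire_colorable R G k -> (n <= k)%N.
Hypothesis upper : exists2 c : X -> 'I_n, coloring G c & forall i, open (c @^-1` [set i]).

Lemma chi_B_BM : is_chi_B R G n /\ is_chi_BM R G n.
Proof.
have [c cP oc] := upper; have [cB cBM] := clopen_colorable R cP oc.
by split; split=> // k /borel_colorable_baire; exact: lower.
Qed.

End ChromaticNumbers.

Theorem corollary1 (R : realType) (k : nat) :
  exists Gamma Delta : markedGroup,
    graph_isomorphic (cayley_graph Gamma) (cayley_graph Delta) /\
    exists bG bD mG mD : nat,
      [/\ is_chi_B R (shift_graph Gamma) bG,
          is_chi_B R (shift_graph Delta) bD,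
          is_chi_BM R (shift_graph Gamma) mG
        & is_chi_BM R (shift_graph Delta) mD] /\
      (bG%:Z - bD%:Z = k%:Z /\ mG%:Z - mD%:Z = k%:Z)%R.
Proof.
have chi_untwisted n := chi_B_BM (@untwisted_lower R n) (untwisted_coloring n).
have chi_twisted n := chi_B_BM (@twisted_lower R n) (twisted_coloring n).
case: k => [|n].
  exists (tz_marked false 0), (tz_marked false 0); split.
    by exists id => //; exists id.
  have [uB uBM] := chi_untwisted 0%N.
  by exists (0 + 4)%N, (0 + 4)%N, (0 + 4)%N, (0 + 4)%N; split; rewrite ?subrr.
exists (tz_marked true n), (tz_marked false n); split.
  exact: tz_cayley_isomorphic.
have [uB uBM] := chi_untwisted n; have [tB tBM] := chi_twisted n.
by exists (n + n + 5)%N, (n + 4)%N, (n + n + 5)%N, (n + 4)%N; split; [|lia].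
Qed.
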